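(* Let $p\in(1,\infty)$, $t_1,t_2>0$, $i\in\{1,\dots,n-1\}$, and let $C_1:=\{x\in\mathbb{K}_p^n:\ t_1x_i\ge1\}$ and $C_2:=\{x\in\mathbb{K}_p^n:\ -t_2x_i\ge1\}$. Let $e^i\in\mathbb{R}^n$ denote the $i$-th standard unit vector. Then $$\mathrm{conv}(C_1\cup C_2)=\Big\{x\in\mathbb{K}_p^n:\ \big\|(t_1+t_2)\tilde x-2(t_2x_i+1)\tilde e^{\,i}\big\|_p\le(t_1+t_2)x_n\Big\}.$$
   Context: For $x\in\mathbb{R}^n$, $\tilde x:=(x_1;\dots;x_{n-1})\in\mathbb{R}^{n-1}$ (so $\tilde e^{\,i}$ consists of the first $n-1$ entries of $e^i$). For $w\in\mathbb{R}^d$, $\|w\|_p:=\big(\sum_{j=1}^d|w_j|^p\big)^{1/p}$. The $p$-order cone is $\mathbb{K}_p^n:=\{x\in\mathbb{R}^n:\|\tilde x\|_p\le x_n\}$. *)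

(* Defs.v *)
From mathcomp Require Import all_boot all_order all_algebra.
From mathcomp Require Import classical_sets reals exp convex.

Set Implicit Arguments.
Unset Strict Implicit.
Unset Printing Implicit Defensive.

Import Order.TTheory GRing.Theory Num.Theory.
Local Open Scope classical_set_scope.
Local Open Scope ring_scope.

Definition pnorm (R : realType) (d : nat) (p : R) (w : 'rV[R]_d) : R :=
  (\sum_(j < d) `|w ord0 j| `^ p) `^ p^-1.

(* The ambient space is R^(n+1), so that the last coordinate, of index
   ord_max, exists. *)
Definition tilde (R : realType) (n : nat) (x : 'rV[R]_n.+1) : 'rV[R]_n :=
  col' ord_max x.

Definition pcone (R : realType) (n : nat) (p : R) : set 'rV[R]_n.+1 :=
  [set x | pnorm p (tilde x) <= x ord0 ord_max].
Arguments pcone {R} n p.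

Definition conv_hull (R : realType) (V : lmodType R) (A : set V) : set V :=
  smallest (@convex_set R V) A.

(* Main.v *)
Require Import Defs.
From mathcomp Require Import all_boot all_order all_algebra.
From mathcomp Require Import ring lra.
From mathcomp Require Import classical_sets reals exp convex.
From mathcomp Require Import interval_inference hoelder.

Set Implicit Arguments.
Unset Strict Implicit.
Unset Printing Implicit Defensive.

Import Order.TTheory GRing.Theory Num.Theory.
Local Open Scope classical_set_scope.
Local Open Scope ring_scope.

(** Write a for x_i and let s(a) = (2 + (t2 - t1) a) / (t1 + t2). This is the
    affine function of a that agrees with |a| at the ends of the strip
    -1/t2 <= a <= 1/t1, that is, the chord of the absolute value over that
    strip. The i-th entry of (t1 + t2) x~ - 2 (t2 x_i + 1) e~^i is
    - (t1 + t2) s(x_i), and its other entries are those of (t1 + t2) x~; as the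
    p-norm only sees absolute values, the second condition on the right-hand
    side says that x still lies in the cone after its i-th entry has been
    replaced by s(x_i) (lemma [pcone_set_chordE]).

    Hull inside the right-hand side: outside the open strip |s(a)| <= |a|, so
    the replacement cannot leave the cone ([norm_chord_le]). Hence C1 and C2 lie
    in the right-hand side, which is convex because s is affine and the cone is
    convex (Minkowski's inequality, [pnormD]).

    Right-hand side inside the hull: a point outside C1 and C2 has x_i in the
    open strip, where s = s(x_i) > 0. Replacing x_i by s or by - s gives two
    points of the cone, and scaling them so that their i-th entries become 1/t1
    and -1/t2 puts them in C1 and C2. Because s is a chord, x is a convex
    combination of the two scaled points: the weights that are right for the
    i-th entry are right for all the others ([strip_combination]). *)

(** * The p-norm *)

Section PNorm.
Context {R : realType} {p : R}.
Hypothesis p1 : 1 <= p.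

Let p0 : 0 < p. Proof. exact: lt_le_trans ltr01 p1. Qed.

Lemma sum_powR_ge0 d (w : 'rV[R]_d) : 0 <= \sum_(j < d) `|w ord0 j| `^ p.
Proof. by apply: sumr_ge0 => j _; exact: powR_ge0. Qed.

Lemma pnorm_ge0 d (w : 'rV[R]_d) : 0 <= pnorm p w.
Proof. exact: powR_ge0. Qed.

Lemma pnorm_powR d (w : 'rV[R]_d) :
  pnorm p w `^ p = \sum_(j < d) `|w ord0 j| `^ p.
Proof.
by rewrite /pnorm -powRrM mulVf ?gt_eqF// powRr1// sum_powR_ge0.
Qed.

Lemma pnorm_leE d (w : 'rV[R]_d) (h : R) : 0 <= h ->
  (pnorm p w <= h) = (\sum_(j < d) `|w ord0 j| `^ p <= h `^ p).
Proof.
move=> h0; rewrite -pnorm_powR; apply/idP/idP => [wh|].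
  by apply: ge0_ler_powR; rewrite ?nnegrE ?pnorm_ge0// ltW.
by apply: contraTT; rewrite -!ltNge; apply: gt0_ltr_powR;
  rewrite ?nnegrE ?pnorm_ge0.
Qed.

Lemma le_pnorm d (w v : 'rV[R]_d) :
  (forall j, `|w ord0 j| <= `|v ord0 j|) -> pnorm p w <= pnorm p v.
Proof.
move=> wv; rewrite pnorm_leE ?pnorm_ge0// pnorm_powR; apply: ler_sum => j _.
by apply: ge0_ler_powR; rewrite ?nnegrE// ltW.
Qed.

Lemma pnormZ d c (w : 'rV[R]_d) : pnorm p (c *: w) = `|c| * pnorm p w.
Proof.
rewrite /pnorm (eq_bigr (fun j => `|c| `^ p * `|w ord0 j| `^ p)); last first.
  by move=> j _; rewrite mxE normrM powRM.
rewrite -mulr_sumr powRM ?powR_ge0 ?sum_powR_ge0//.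
by rewrite -powRrM mulfV ?gt_eqF// powRr1.
Qed.

Lemma pnorm_eq0 d (w : 'rV[R]_d) : pnorm p w = 0 -> w = 0.
Proof.
move=> /powR_eq0_eq0 /eqP; rewrite psumr_eq0 => [/allP w0|j _]; last first.
  exact: powR_ge0.
apply/rowP => j; rewrite mxE.
have /eqP := w0 j (mem_index_enum _).
by move=> /powR_eq0_eq0 /normr0_eq0.
Qed.

(** Convexity of the p-th power, applied to |w_j| / a and |v_j| / b with weights
    a / (a + b) and b / (a + b): their weighted mean is (|w_j| + |v_j|) / (a + b),
    and since the p-th powers of either family sum to at most 1, so do those of
    the means. *)
Lemma pnormD_le d (w v : 'rV[R]_d) (a b : R) : 0 < a -> 0 < b ->
  pnorm p w <= a -> pnorm p v <= b -> pnorm p (w + v) <= a + b.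
Proof.
move=> a0 b0.
have ab0 : 0 < a + b by exact: addr_gt0.
move=> wa vb; rewrite (pnorm_leE _ (ltW ab0)).
rewrite (pnorm_leE _ (ltW a0)) in wa; rewrite (pnorm_leE _ (ltW b0)) in vb.
pose t := a / (a + b).
have t0 : 0 <= t by rewrite divr_ge0// ltW.
have t1 : t <= 1 by rewrite ler_pdivrMr// mul1r lerDl ltW.
have tC : 1 - t = b / (a + b) by rewrite /t; field; rewrite gt_eqF.
have le_term j : `|(w + v) ord0 j| `^ p <= (a + b) `^ p *
    (t * (`|w ord0 j| `^ p / a `^ p) + (1 - t) * (`|v ord0 j| `^ p / b `^ p)).
  have wa0 : 0 <= `|w ord0 j| / a by rewrite divr_ge0// ltW.
  have vb0 : 0 <= `|v ord0 j| / b by rewrite divr_ge0// ltW.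
  have divpE x c : 0 < c -> (`|x| / c) `^ p = `|x| `^ p / c `^ p.
    move=> c0; rewrite powRM ?invr_ge0 ?(ltW c0)//.
    by rewrite -(powR_inv1 (ltW c0)) powRAC powR_inv1// powR_ge0.
  have cvx : (t * (`|w ord0 j| / a) + (1 - t) * (`|v ord0 j| / b)) `^ p <=
      t * (`|w ord0 j| / a) `^ p + (1 - t) * (`|v ord0 j| / b) `^ p.
    by apply: (convex_powR p1 (Itv01 t0 t1)); rewrite inE /= in_itv/= andbT.
  rewrite -!divpE//; apply: le_trans (ler_wpM2l (powR_ge0 _ _) cvx).
  rewrite -powRM ?(ltW ab0)//; last first.
    by rewrite addr_ge0// mulr_ge0// subr_ge0.
  rewrite tC /t.
  have -> : (a + b) * (a / (a + b) * (`|w ord0 j| / a) +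
      b / (a + b) * (`|v ord0 j| / b)) = `|w ord0 j| + `|v ord0 j|.
    by field; rewrite !gt_eqF.
  apply: ge0_ler_powR; rewrite ?nnegrE ?addr_ge0 ?(ltW p0)//.
  by rewrite mxE ler_normD.
apply: le_trans (ler_sum _ (fun j _ => le_term j)) _.
rewrite -mulr_sumr big_split /= -!mulr_sumr -!mulr_suml.
rewrite ler_piMr ?powR_ge0// -[leRHS](subrK t) addrC.
have powV_le1 S c : 0 < c -> S <= c `^ p -> S / c `^ p <= 1.
  by move=> c0 Sc; rewrite ler_pdivrMr ?powR_gt0// mul1r.
by rewrite lerD// ler_piMr ?subr_ge0// powV_le1.
Qed.

Lemma pnormD d (w v : 'rV[R]_d) : pnorm p (w + v) <= pnorm p w + pnorm p v.
Proof.
have [/pnorm_eq0 ->|w0] := eqVneq (pnorm p w) 0.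
  by rewrite add0r lerDr pnorm_ge0.
have [/pnorm_eq0 ->|v0] := eqVneq (pnorm p v) 0.
  by rewrite addr0 lerDl pnorm_ge0.
have gt0 (u : 'rV[R]_d) : pnorm p u != 0 -> 0 < pnorm p u.
  by move=> u0; rewrite lt_neqAle eq_sym u0 pnorm_ge0.
exact: pnormD_le (gt0 _ w0) (gt0 _ v0) (lexx _) (lexx _).
Qed.

End PNorm.

(** * The p-order cone and replacement of a coordinate *)

Lemma pcone_comb (R : realType) n (p a b : R) (x y : 'rV[R]_n.+1) : 1 <= p ->
  0 <= a -> 0 <= b -> pcone n p x -> pcone n p y -> pcone n p (a *: x + b *: y).
Proof.
rewrite /pcone /= => p1 a0 b0 xK yK.
have -> : tilde (a *: x + b *: y) = a *: tilde x + b *: tilde y.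
  by apply/rowP => j; rewrite !mxE.
apply: le_trans (pnormD p1 _ _) _.
by rewrite !pnormZ// !ger0_norm// !mxE lerD// ler_wpM2l.
Qed.

Lemma pconeZ (R : realType) n (p a : R) (x : 'rV[R]_n.+1) : 1 <= p ->
  0 <= a -> pcone n p x -> pcone n p (a *: x).
Proof.
move=> p1 a0 xK.
by have := pcone_comb p1 a0 (lexx 0) xK xK; rewrite scale0r addr0.
Qed.

Definition set_coord (R : realType) n (i : 'I_n) (r : R) (x : 'rV[R]_n) :
  'rV[R]_n := \row_j (if j == i then r else x ord0 j).

Lemma set_coord_id (R : realType) n (i : 'I_n) (x : 'rV[R]_n) :
  set_coord i (x ord0 i) x = x.
Proof. by apply/rowP => j; rewrite mxE; case: eqP => [->|]. Qed.

Lemma ord_max_neq n (i : 'I_n.+1) : (i < n)%N -> (ord_max == i) = false.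
Proof. by move=> hi; rewrite -val_eqE /= gtn_eqF. Qed.

Lemma pcone_set_coord_le (R : realType) n (p q r : R) (i : 'I_n.+1)
    (x : 'rV[R]_n.+1) : 1 <= p -> (i < n)%N -> `|q| <= `|r| ->
  pcone n p (set_coord i r x) -> pcone n p (set_coord i q x).
Proof.
move=> p1 hi qr.
have lastE s : set_coord i s x ord0 ord_max = x ord0 ord_max.
  by rewrite mxE ord_max_neq.
have le_qr : pnorm p (tilde (set_coord i q x))
    <= pnorm p (tilde (set_coord i r x)).
  by apply: (le_pnorm p1) => j; rewrite !mxE; case: ifP.
by rewrite /pcone /= !lastE; exact: le_trans le_qr.
Qed.

(** * The chord of the absolute value *)

Section Chord.
Context {R : realType} (t1 t2 : R).
Hypotheses (ht1 : 0 < t1) (ht2 : 0 < t2).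

(** The affine function with the values of |a| at a = 1/t1 and a = -1/t2. *)
Definition chord (a : R) := (2 + (t2 - t1) * a) / (t1 + t2).

Let t12 : 0 < t1 + t2. Proof. exact: addr_gt0. Qed.

Lemma chord_gt0 a : t1 * a < 1 -> - t2 * a < 1 -> 0 < chord a.
Proof. by move=> h1 h2; rewrite divr_gt0//; lra. Qed.

(** Convexity puts |a| above its chord outside the strip. For - chord a it is
    enough that the slope of the chord has absolute value less than 1 and that
    the chord is nonnegative where it meets the graph. *)
Lemma norm_chord_le a : 1 <= t1 * a \/ 1 <= - t2 * a -> `|chord a| <= `|a|.
Proof.
rewrite /chord normrM normfV (gtr0_norm t12) ler_pdivrMr// => -[h|h].
  have a0 : 0 < a by rewrite -(pmulr_rgt0 _ ht1); lra.
  have := mulr_gt0 ht2 a0.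
  by rewrite (gtr0_norm a0) ler_norml => ?; apply/andP; split; lra.
have a0 : a < 0 by rewrite -oppr_gt0 -(pmulr_rgt0 _ ht2); lra.
have : t1 * a < 0 by rewrite pmulr_rlt0.
by rewrite (ltr0_norm a0) ler_norml => ?; apply/andP; split; lra.
Qed.

Lemma chord_conv (a b t : R) :
  chord (t * a + (1 - t) * b) = t * chord a + (1 - t) * chord b.
Proof. by rewrite /chord; field; rewrite gt_eqF. Qed.

(** The vector under the norm is (t1 + t2) times x~ with - chord x_i in place of
    x_i, and the sign does not matter to the cone. *)
Lemma pcone_set_chordE n p (i : 'I_n.+1) (x : 'rV[R]_n.+1) :
  1 <= p -> (i < n)%N ->
  pnorm p ((t1 + t2) *: tilde x
      - (2 * (t2 * x ord0 i + 1)) *: tilde (delta_mx ord0 i : 'rV[R]_n.+1))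
    <= (t1 + t2) * x ord0 ord_max <->
  pcone n p (set_coord i (chord (x ord0 i)) x).
Proof.
move=> p1 hi; set c := chord _.
have -> : (t1 + t2) *: tilde x
    - (2 * (t2 * x ord0 i + 1)) *: tilde (delta_mx ord0 i : 'rV[R]_n.+1)
    = (t1 + t2) *: tilde (set_coord i (- c) x).
  apply/rowP => j; rewrite !mxE eqxx /=; case: eqP => [->|_] /=.
    by rewrite /c /chord; field; rewrite gt_eqF.
  by rewrite mulr0 subr0.
rewrite pnormZ// (gtr0_norm t12) ler_pM2l//.
have <- : set_coord i (- c) x ord0 ord_max = x ord0 ord_max.
  by rewrite mxE ord_max_neq.
by split; apply: pcone_set_coord_le; rewrite ?normrN.
Qed.

Lemma strip_combination n (i : 'I_n) (x : 'rV[R]_n) :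
  let a := x ord0 i in let t := t1 * (t2 * a + 1) / (t1 + t2) in
  chord a != 0 ->
  x = t *: ((t1 * chord a)^-1 *: set_coord i (chord a) x)
    + (1 - t) *: ((t2 * chord a)^-1 *: set_coord i (- chord a) x).
Proof.
move=> a t ca0; have t10 := lt0r_neq0 ht1; have t20 := lt0r_neq0 ht2.
have t120 := lt0r_neq0 t12.
(* Besides the normalisation by chord a, the weights of the two replaced points
   are (t2 a + 1) / (t1 + t2) and (1 - t1 a) / (t1 + t2): their sum is chord a,
   which settles the entries other than i, and their difference is a. *)
have e1 : t * (t1 * chord a)^-1 = (t2 * a + 1) / (t1 + t2) / chord a.
  by rewrite /t; field; rewrite ca0 t10 t120.
have e2 : (1 - t) * (t2 * chord a)^-1 = (1 - t1 * a) / (t1 + t2) / chord a.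
  by rewrite /t; field; rewrite ca0 t20 t120.
rewrite !scalerA e1 e2; apply/rowP => j; rewrite !mxE.
case: eqP => [->|_]; first by rewrite -/a; field; rewrite ca0 t120.
rewrite -mulrDl -mulrDl -mulrDl.
have -> : t2 * a + 1 + (1 - t1 * a) = 2 + (t2 - t1) * a by ring.
by rewrite -/(chord a) divff// mul1r.
Qed.

End Chord.

(** * The convex hull *)

Theorem corollary3 (R : realType) (n : nat) (p t1 t2 : R) (i : 'I_n.+1)
    (hp : 1 < p) (ht1 : 0 < t1) (ht2 : 0 < t2) (hi : (i < n)%N) :
  let C1 : set 'rV[R]_n.+1 := [set x | pcone n p x /\ 1 <= t1 * x ord0 i] in
  let C2 : set 'rV[R]_n.+1 := [set x | pcone n p x /\ 1 <= - t2 * x ord0 i] in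
  let e : 'rV[R]_n.+1 := delta_mx ord0 i in
  conv_hull (C1 `|` C2) =
  [set x : 'rV[R]_n.+1 | pcone n p x /\
    pnorm p ((t1 + t2) *: tilde x - (2 * (t2 * x ord0 i + 1)) *: tilde e)
      <= (t1 + t2) * x ord0 ord_max].
Proof.
move=> C1 C2 e; have p1 := ltW hp.
pose D : set 'rV[R]_n.+1 := [set x | pcone n p x /\
  pcone n p (set_coord i (chord t1 t2 (x ord0 i)) x)].
transitivity D; last first.
  by apply/seteqP; split => x [xK xD]; split => //;
    apply/(pcone_set_chordE ht1 ht2 _ p1 hi).
apply/seteqP; split.
  apply: smallest_sub => [x y t|x CUx].
    rewrite !inE => -[xK xD] [yK yD].
    have t0 : 0 <= t%:num by [].
    have t1' : 0 <= 1 - t%:num by rewrite subr_ge0.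
    split; first exact: pcone_comb.
    have := pcone_comb p1 t0 t1' xD yD; congr (pcone n p _).
    apply/rowP => j; rewrite !mxE; case: eqP => // _.
    by rewrite chord_conv.
  have [xK xi] : pcone n p x /\ (1 <= t1 * x ord0 i \/ 1 <= - t2 * x ord0 i).
    by case: CUx => -[? ?]; split=> //; [left|right].
  split => //; apply: (pcone_set_coord_le p1 hi (norm_chord_le ht1 ht2 xi)).
  by rewrite set_coord_id.
move=> x [xK xD] M [cM CM].
have [h1|h1] := leP 1 (t1 * x ord0 i); first by apply: CM; left.
have [h2|h2] := leP 1 (- t2 * x ord0 i); first by apply: CM; right.
have c0 := chord_gt0 ht1 ht2 h1 h2.
have t12 := addr_gt0 ht1 ht2.
set c := chord t1 t2 (x ord0 i) in c0 xD *.
pose t := t1 * (t2 * x ord0 i + 1) / (t1 + t2).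
have t_ge0 : 0 <= t.
  by rewrite divr_ge0 ?(ltW t12)// mulr_ge0 ?(ltW ht1)//; lra.
have t_le1 : t <= 1.
  rewrite ler_pdivrMr// mul1r -subr_ge0.
  have -> : t1 + t2 - t1 * (t2 * x ord0 i + 1) = t2 * (1 - t1 * x ord0 i).
    by ring.
  by rewrite mulr_ge0 ?(ltW ht2)//; lra.
have yM : (t1 * c)^-1 *: set_coord i c x \in M.
  rewrite inE; apply: CM; left; split.
    by apply: pconeZ => //; rewrite invr_ge0 mulr_ge0// ltW.
  rewrite !mxE eqxx.
  have -> : t1 * ((t1 * c)^-1 * c) = 1 by field; rewrite !gt_eqF.
  exact: lexx.
have zM : (t2 * c)^-1 *: set_coord i (- c) x \in M.
  rewrite inE; apply: CM; right; split.
    apply: pconeZ => //; first by rewrite invr_ge0 mulr_ge0// ltW.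
    by apply: pcone_set_coord_le xD; rewrite ?normrN.
  rewrite !mxE eqxx.
  have -> : - t2 * ((t2 * c)^-1 * - c) = 1 by field; rewrite !gt_eqF.
  exact: lexx.
have := cM _ _ (Itv01 t_ge0 t_le1) yM zM; rewrite inE; congr (M _).
exact/esym/(strip_combination ht1 ht2 (lt0r_neq0 c0)).
Qed.
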